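(* Let $\alpha$ be a Salem number of degree $d$. Let $\eta=\frac1L(l_0+l_1\alpha+\dots+l_{d-1}\alpha^{d-1})\in\mathbb{Q}(\alpha)$ be in reduced form (that is, $L\in\mathbb{N}$, $L\ge1$, $l_0,\dots,l_{d-1}\in\mathbb{Z}$ and $\gcd(l_0,\dots,l_{d-1},L)=1$), and suppose that $\mathrm{Tr}(L\eta\alpha^n)\equiv0\pmod L$ for all $n=0,\dots,d-1$. Then $L$ divides $E(\alpha)$, where $E(\alpha)$ is the least common multiple of the denominators, in reduced form, of the elements of the basis of $\mathbb{Q}(\alpha)$ dual to $\{1,\alpha,\dots,\alpha^{d-1}\}$ with respect to the trace form.
   Context: Salem number: a real algebraic integer $\alpha>1$ all of whose other Galois conjugates lie in the closed unit disk, with at least one on the unit circle. Trace: $\mathrm{Tr}(\eta)=\sum_{\sigma:\mathbb{Q}(\alpha)\hookrightarrow\mathbb{C}}\sigma(\eta)$ over all embeddings of $\mathbb{Q}(\alpha)$ into $\mathbb{C}$; the trace form is $(x,y)\mapsto\mathrm{Tr}(xy)$. The dual basis $\{w_0,\dots,w_{d-1}\}$ is defined by $\mathrm{Tr}(\alpha^iw_j)=\delta_{ij}$ for $0\le i,j\le d-1$. The denominator of $w\in\mathbb{Q}(\alpha)$ in reduced form is the $L\ge1$ in the unique expression $w=\frac1L(l_0+\dots+l_{d-1}\alpha^{d-1})$ with $l_i\in\mathbb{Z}$ and $\gcd(l_0,\dots,l_{d-1},L)=1$. *)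

(* Defs.v *)
From mathcomp Require Export all_boot all_order all_algebra all_field.
From mathcomp Require Export boolp classical_sets fsbigop.

Set Implicit Arguments.
Unset Strict Implicit.
Unset Printing Implicit Defensive.

Import Order.TTheory GRing.Theory Num.Theory.

Local Open Scope ring_scope.

(* The conjugates of an algebraic number, and its images under the embeddings
   of a number field into the complex numbers, are algebraic, so everything
   takes place in [algC]. *)

(* The order of [algC] is partial: [1 < alpha] forces [alpha] to be real. *)
Definition salem (alpha : algC) : Prop :=
  [/\ alpha \in Aint,
      1 < alpha,
      (forall beta, root (minCpoly alpha) beta -> beta != alpha ->
         `|beta| <= 1)
    & exists beta,
        [/\ root (minCpoly alpha) beta, beta != alpha & `|beta| = 1]].

Section NumberField.
Variable K : fieldExtType rat.

Definition embeddings : set (K -> algC) :=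
  range (fun sigma : {rmorphism K -> algC} => (sigma : K -> algC)).

Definition Tr (x : K) : algC := \sum_(sigma \in embeddings) sigma x.

Variables (d : nat) (a : K).

Definition dual_basis (w : 'I_d -> K) : Prop :=
  forall i j : 'I_d, Tr (a ^+ i * w j) = (i == j)%:R.

Definition reduced_form (x : K) (L : nat) (l : 'I_d -> int) : Prop :=
  [/\ (1 <= L)%N,
      x = (L%:R)^-1 * \sum_(i < d) (l i)%:~R * a ^+ i
    & gcdn (\big[gcdn/0%N]_(i < d) `|l i|%N) L = 1%N].

(* When [a] generates [K] and has degree [d], exactly one [L] occurs in a
   reduced form of [x]; the default value 1 is then irrelevant. *)
Definition denominator (x : K) : nat :=
  xget 1%N [set L : nat | exists l, reduced_form x L l]%classic.

Definition lcm_denominators (w : 'I_d -> K) : nat :=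
  \big[lcmn/1%N]_(j < d) denominator (w j).

End NumberField.

(* Main.v *)
(* Nondegeneracy of the trace form gives eta = sum_j Tr(eta a^j) w_j, and the
   traces Tr(eta a^j) are integers by hypothesis.  Hence E(alpha) eta lies in
   Z[a].  The powers 1, a, ..., a^(d-1) being independent, L divides every
   E(alpha) l_i, hence E(alpha) itself since the l_i and L are coprime. *)
Require Import Defs.
From mathcomp Require Import cardinality.

Set Implicit Arguments.
Unset Strict Implicit.
Unset Printing Implicit Defensive.

Import Order.TTheory GRing.Theory Num.Theory.

Local Open Scope ring_scope.

(** A ring morphism out of [K] restricts along [in_alg K] to a ring morphism out of [rat], which can
    only be [ratr]; this supplies the rational linearity of the embeddings. *)
Lemma fmorph_ratZ (K : fieldExtType rat) (R : unitRingType)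
    (f : {rmorphism K -> R}) (c : rat) (x : K) :
  f (c *: x) = ratr c * f x.
Proof.
rewrite -mulr_algl rmorphM; congr (_ * _).
exact: (fmorph_eq_rat (f \o in_alg K)).
Qed.

Lemma fmorph_horner_rat (K : fieldExtType rat) (R : unitRingType)
    (f : {rmorphism K -> R}) (q : {poly rat}) (x : K) :
  f (map_poly (in_alg K) q).[x] = (map_poly ratr q).[f x].
Proof.
rewrite -horner_map -map_poly_comp; congr (_.[_]); apply: eq_map_poly => c /=.
exact: (fmorph_eq_rat (f \o in_alg K)).
Qed.

Lemma rat_ext_intr_eq0 (K : fieldExtType rat) (m : int) :
  (m%:~R == 0 :> K) = (m == 0).
Proof. by rewrite -(rmorph_int (in_alg K)) fmorph_eq0 intr_eq0. Qed.

Section Generator.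
Variables (alpha : algC) (K : fieldExtType rat) (a : K).
Variables (iota : {rmorphism K -> algC}).
Hypotheses (hiota : iota a = alpha) (hK : <<1%VS; a>>%VS = fullv).

Lemma generator_poly (x : K) : exists q, x = (map_poly (in_alg K) q).[a].
Proof.
have xK : x \in <<1%VS; a>>%VS by rewrite hK memvf.
have /polyOver1P[q Dq] := Fadjoin_polyOver 1%VS a x.
by exists q; rewrite -Dq (Fadjoin_poly_eq xK).
Qed.

Lemma generator_root : exists2 p : {poly rat},
  minCpoly alpha = map_poly ratr p & (map_poly (in_alg K) p).[a] = 0.
Proof.
have [p [Dp _] _] := minCpolyP alpha; exists p => //.
apply: (fmorph_inj iota); rewrite fmorph_horner_rat hiota rmorph0 -Dp.
exact/rootP/root_minCpoly.
Qed.

(** Reduction modulo the minimal polynomial, which has degree [d] and kills [a]. *)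
Lemma generator_coords d (hd : size (minCpoly alpha) = d.+1) (x : K) :
  exists2 q : {poly rat}, (size q <= d)%N & x = (map_poly (in_alg K) q).[a].
Proof.
have [q ->] := generator_poly x; have [p Dp pa0] := generator_root.
exists (q %% p).
  rewrite -ltnS -hd Dp size_map_poly ltn_modp.
  by rewrite -(map_poly_eq0 (ratr : rat -> algC)) -Dp minCpoly_eq0.
by rewrite {1}(divp_eq q p) rmorphD rmorphM hornerD hornerM pa0 mulr0 add0r.
Qed.

(** A nontrivial relation would be a nonzero rational polynomial of degree below [d] vanishing at
    [alpha], yet divisible by the minimal polynomial. *)
Lemma generator_free d (hd : size (minCpoly alpha) = d.+1) (c : 'I_d -> int) :
  \sum_(i < d) (c i)%:~R * a ^+ i = 0 -> forall i, c i = 0.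
Proof.
move=> c0; have [p [Dp _] pmin] := minCpolyP alpha.
pose q : {poly rat} := \sum_(i < d) ((c i)%:~R)%:P * 'X^i.
have q0 : q = 0.
  have: root (map_poly ratr q) alpha.
    apply/rootP; rewrite -hiota -fmorph_horner_rat.
    suff -> : (map_poly (in_alg K) q).[a] = 0 by rewrite rmorph0.
    rewrite -[RHS]c0 rmorph_sum horner_sum; apply: eq_bigr => i _.
    by rewrite rmorphM /= map_polyC map_polyXn hornerCM hornerXn /= scaler_int.
  rewrite pmin; have [-> //|qn0] := eqVneq q 0.
  move/(dvdp_leq qn0); rewrite leqNgt => /negP[].
  rewrite -(size_map_poly (ratr : {rmorphism rat -> algC}) p) -Dp hd ltnS.
  apply: (leq_trans (size_sum _ _ _)); apply/bigmax_leqP => i _.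
  by rewrite mul_polyC (leq_trans (size_scale_leq _ _)) ?size_polyXn.
move=> i; have := congr1 (coefp i) q0.
rewrite /= coef0 coef_sum (bigD1 i) //= coefCM coefXn eqxx mulr1 big1 ?addr0.
  by move/eqP; rewrite intr_eq0 => /eqP.
move=> j ji; rewrite coefCM coefXn eq_sym (inj_eq val_inj) (negPf ji).
by rewrite mulr0.
Qed.

(** An embedding is determined by its value at [a], which is one of the finitely many roots of
    [minCpoly alpha]. This turns the sum defining [Tr] into an honest finite sum, hence additive. *)
Lemma finite_embeddings : finite_set (@embeddings K).
Proof.
have [p Dp pa0] := generator_root.
have [s Ds] := closed_field_poly_normal (minCpoly alpha).
pose ev (f : K -> algC) := f a.
have ev_inj : {in @embeddings K &, injective ev}.
  move=> _ _ /set_mem[f _ <-] /set_mem[g _ <-] fga; apply/funext => x.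
  by have [q ->] := generator_poly x; rewrite !fmorph_horner_rat [f a]fga.
rewrite -(eq_finite_set (inj_card_eq ev_inj)).
apply: sub_finite_set (finite_seq s) => _ /= [_ [f _ <-] <-].
suff: root (minCpoly alpha) (f a).
  by rewrite Ds (monicP (minCpoly_monic alpha)) scale1r root_prod_XsubC.
by apply/rootP; rewrite Dp -fmorph_horner_rat pa0 rmorph0.
Qed.

Lemma TrD (x y : K) : Tr (x + y) = Tr x + Tr y.
Proof.
rewrite /Tr !fsbig_finite; try exact: finite_embeddings.
rewrite -big_split; apply: eq_big_seq => s.
rewrite in_fset_set => [/set_mem[f _ <-]|]; last exact: finite_embeddings.
exact: rmorphD.
Qed.

Lemma TrZ (c : rat) (x : K) : Tr (c *: x) = ratr c * Tr x.
Proof.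
rewrite /Tr mulr_fsumr; apply: eq_fsbigr => s /set_mem[f _ <-].
exact: fmorph_ratZ.
Qed.

Lemma Tr0 : Tr (0 : K) = 0.
Proof. by have := TrZ 0 0; rewrite scale0r rmorph0 mul0r. Qed.

Lemma Tr_sum (I : Type) (r : seq I) (P : pred I) (F : I -> K) :
  Tr (\sum_(i <- r | P i) F i) = \sum_(i <- r | P i) Tr (F i).
Proof. exact: (big_morph _ TrD Tr0). Qed.

Lemma TrMz (m : int) (x : K) : Tr (m%:~R * x) = m%:~R * Tr x.
Proof. by rewrite -(ratr_int algC) -TrZ scaler_int mulrzl. Qed.

(* The trace is not identically zero because Tr (a ^+ 0 * w 0) = 1. *)
Lemma Tr_nondegenerate d (hd : size (minCpoly alpha) = d.+1) (w : 'I_d -> K)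
    (hw : dual_basis a w) (x : K) :
  (forall i : 'I_d, Tr (a ^+ i * x) = 0) -> x = 0.
Proof.
move=> x0; have [//|xn0] := eqVneq x 0.
(* The powers of [a] below [d] span [K], so [x] is orthogonal to all of [K]; further down, [y] is
   taken to be [w i / x]. *)
have TrMx y : Tr (y * x) = 0.
  have [q szq ->] := generator_coords hd y.
  rewrite (horner_coef_wide _ (leq_trans (size_poly _ _) szq)).
  rewrite mulr_suml Tr_sum big1 // => i _.
  by rewrite coef_map /= mulr_algl -scalerAl TrZ x0 mulr0.
have d_gt0 : (0 < d)%N by rewrite -ltnS -hd size_minCpoly.
pose i := Ordinal d_gt0.
have := hw i i; rewrite eqxx expr0 mul1r -[w i](mulfVK xn0) TrMx.
by move/esym/eqP; rewrite oner_eq0.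
Qed.

(** Both sides have the same trace against every [a ^+ i], so nondegeneracy identifies them. *)
Lemma dual_basis_expansion d (hd : size (minCpoly alpha) = d.+1)
    (w : 'I_d -> K) (hw : dual_basis a w) (x : K) (m : 'I_d -> int) :
  (forall i : 'I_d, Tr (x * a ^+ i) = (m i)%:~R) ->
  x = \sum_(j < d) (m j)%:~R * w j.
Proof.
move=> xm; apply/eqP; rewrite -subr_eq0; apply/eqP.
apply: (Tr_nondegenerate hd hw) => i.
rewrite mulrBr -scaleN1r TrD TrZ rmorphN1 mulN1r mulrC xm mulr_sumr Tr_sum.
rewrite (bigD1 i) //= mulrCA TrMz hw eqxx big1 => [|j ji].
  by rewrite addr0 mulr1 subrr.
by rewrite mulrCA TrMz hw eq_sym (negPf ji) mulr0.
Qed.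

Lemma exists_reduced_form d (hd : size (minCpoly alpha) = d.+1) (x : K) :
  exists L (l : 'I_d -> int), reduced_form a x L l.
Proof.
have [q szq ->] := generator_coords hd x.
have [z [A An0 Dq]] := rat_poly_scale q.
pose c (i : 'I_d) : int := z`_i.
pose g := gcdn (\big[gcdn/0%N]_(i < d) `|c i|%N) `|A|.
have gA : (g %| `|A|)%N by exact: dvdn_gcdr.
have g_gt0 : (0 < g)%N by rewrite gcdn_gt0 absz_gt0 An0 orbT.
(* The common denominator [A] may be negative: its sign moves into the numerators, and [g] is the
   factor to cancel. *)
pose l (i : 'I_d) : int := (sgz A * c i %/ g)%Z.
have gl (i : 'I_d) : l i * g = sgz A * c i.
  have gc : (g %| `|c i|)%N.
    by move/dvdn_biggcdP: (dvdn_gcdl _ _ : (g %| _)%N); apply.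
  by apply/divzK; rewrite dvdzE abszM /= dvdn_mull.
have abs_c (i : 'I_d) : `|c i|%N = (g * `|l i|)%N.
  by rewrite mulnC -[g]/(`|g|)%N -abszM gl abszM absz_sg An0 mul1n.
exists (`|A| %/ g)%N, l; split.
- by rewrite divn_gt0 // dvdn_leq // absz_gt0.
- rewrite (horner_coef_wide _ (leq_trans (size_poly _ _) szq)) mulr_sumr.
  apply: eq_bigr => i _; rewrite mulrA; congr (_ * _).
  rewrite coef_map Dq coefZ coef_map /= -[z`_i]/(c i).
  have AK : A%:~R != 0 :> K by rewrite rat_ext_intr_eq0.
  have NK : (`|A| %/ g)%:R != 0 :> K.
    rewrite (rat_ext_intr_eq0 K (_ %/ _)%N) -lt0n divn_gt0 // dvdn_leq //.
    by rewrite absz_gt0.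
  have cN : c i * (`|A| %/ g)%N = A * l i.
    have g0 : g%:Z != 0 by rewrite eqz_nat -lt0n.
    apply: (mulIf g0); rewrite -!mulrA gl -PoszM divnK // abszEsg.
    by rewrite mulrCA [c i * A]mulrC [A * (_ * _)]mulrCA.
  transitivity (A%:~R^-1 * (c i)%:~R : K).
    rewrite -(rmorph_int (in_alg K) A) -(rmorph_int (in_alg K) (c i)).
    by rewrite -fmorphV -rmorphM.
  apply: (mulfI AK); apply: (mulIf NK).
  rewrite mulVKf // -mulrA [_ * _%:R]mulrC [_^-1 * _]mulrC divfK //.
  by rewrite -[_%:R]/(_%:Z%:~R) -!rmorphM /= -cN mulrC.
(* Multiplied by [g], this gcd becomes the one that defines [g]. *)
- apply/eqP; rewrite -(eqn_pmul2l g_gt0) muln1 muln_gcdr.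
  rewrite [(g * (_ %/ _))%N]mulnC divnK // (big_morph (muln g) (muln_gcdr g) (muln0 g)).
  by under eq_bigr do rewrite -abs_c.
Qed.

(** Existence ensures that [xget] returns an actual denominator and not its default value. *)
Lemma denominator_reduced_form d (hd : size (minCpoly alpha) = d.+1) (x : K) :
  exists l : 'I_d -> int, reduced_form a x (denominator d a x) l.
Proof. exact: xgetPex (exists_reduced_form hd x). Qed.

End Generator.


(* [K] is a copy of Q(alpha), embedded in the complex numbers by [iota], with
   [a] the element corresponding to [alpha]. *)
Theorem proposition1p3 (alpha : algC) (halpha : salem alpha)
    (d : nat) (hd : size (minCpoly alpha) = d.+1)
    (K : fieldExtType rat) (a : K) (iota : {rmorphism K -> algC})
    (hiota : iota a = alpha) (hK : <<1%VS; a>>%VS = fullv)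
    (eta : K) (L : nat) (l : 'I_d -> int)
    (heta : reduced_form a eta L l)
    (hTr : forall n : nat, (n < d)%N ->
       (Tr (L%:R * eta * a ^+ n) == 0 %[mod L])%C)
    (w : 'I_d -> K) (hw : dual_basis a w) :
  (L %| lcm_denominators a w)%N.
Proof.
have [L_gt0 Deta hgcd] := heta.
have Ln0 : L%:R != 0 :> K by rewrite (rat_ext_intr_eq0 K L) -lt0n.
have LnC : L%:R != 0 :> algC by rewrite pnatr_eq0 -lt0n.
(* Divisibility in [algC] means that the quotient is a rational integer, so cancelling [L] leaves an
   integral trace. *)
have Trint (n : 'I_d) : exists m : int, Tr (eta * a ^+ n) = m%:~R.
  have := hTr n (ltn_ord n); rewrite /eqCmod subr0 -mulrA.
  rewrite -[X in Tr (X * _)]/(L%:Z%:~R) TrMz.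
  rewrite -[X in (X %| _)%C]mulr1 dvdC_mul2l // => /dvdCP[z zint ->].
  by rewrite mulr1; exists (Num.floor z); rewrite (floorK zint).
have [m Dm] := boolp.choice Trint.
have Deta' := dual_basis_expansion hiota hK hd hw Dm.
set E := lcm_denominators a w.
(* The denominator of [w j] divides [E], so the cofactor [k] scales its reduced numerators to
   integer coordinates of [E w_j]. *)
have Ew (j : 'I_d) : exists c : 'I_d -> int,
    E%:R * w j = \sum_(i < d) (c i)%:~R * a ^+ i.
  have [lj [Lj_gt0 Dw _]] := denominator_reduced_form hiota hK hd (w j).
  have /dvdnP[k Dk] : (denominator d a (w j) %| E)%N.
    exact: (biglcmn_sup j).
  exists (fun i => k%:Z * lj i); rewrite Dw Dk natrM -mulrA mulVKf.
    rewrite mulr_sumr; apply: eq_bigr => i _.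
    by rewrite mulrA rmorphM.
  by rewrite (rat_ext_intr_eq0 K (denominator _ _ _)) -lt0n.
have [c Dc] := boolp.choice Ew.
(* Coordinates of [E L eta], computed from the reduced form of [eta] on the left and from the dual
   expansion on the right; [S] below is [E eta]. *)
have El i : E%:Z * l i = L%:Z * \sum_(j < d) m j * c j i.
  apply/eqP; rewrite -subr_eq0; apply/eqP; move: i.
  apply: (generator_free hiota hd).
  pose S := \sum_(j < d) (m j)%:~R * (E%:R * w j).
  have S1 : S = \sum_(i < d) (\sum_(j < d) m j * c j i)%:~R * a ^+ i.
    under eq_bigr do rewrite rmorph_sum mulr_suml /=.
    rewrite exchange_big; apply: eq_bigr => j _.
    by rewrite Dc mulr_sumr; apply: eq_bigr => i _; rewrite rmorphM mulrA.
  have S2 : S = E%:R * eta.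
    by rewrite Deta' mulr_sumr; apply: eq_bigr => j _; rewrite mulrCA.
  have S3 : L%:R * S = E%:R * \sum_(i < d) (l i)%:~R * a ^+ i.
    by rewrite S2 Deta mulrCA mulVKf.
  apply/eqP; under eq_bigr do rewrite rmorphB mulrBl !rmorphM /=.
  rewrite sumrB subr_eq0; apply/eqP; under eq_bigr do rewrite -mulrA.
  rewrite -mulr_sumr; under [RHS]eq_bigr do rewrite -mulrA.
  by rewrite -mulr_sumr -S1 S3.
(* The gcd of the [E l_i] is [E] times the gcd of the [l_i], and the latter is coprime to [L]. *)
suff: (L %| E * \big[gcdn/0%N]_(i < d) `|l i|)%N.
  by rewrite Gauss_dvdl // coprime_sym /coprime hgcd.
rewrite (big_morph (muln E) (muln_gcdr E) (muln0 E)).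
apply/dvdn_biggcdP => i _.
by rewrite -[E]/(`|E|)%N -abszM El abszM dvdn_mulr.
Qed.
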